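(* For $i=1,2$ let $R_i$ be a unital commutative ring whose additive group is finitely generated and torsion-free. If the topological groupoids $(\mathbb Q R_1\rtimes(\mathbb Q R_1)^* )\ltimes\overline{R_1}$ and $(\mathbb Q R_2\rtimes(\mathbb Q R_2)^* )\ltimes\overline{R_2}$ are isomorphic, then $\mathbb Q R_1\cong\mathbb Q R_2$ as $\mathbb Q$-algebras.
   Context: $\mathbb QR=\mathbb Q\otimes_{\mathbb Z}R$, a finite-dimensional $\mathbb Q$-algebra containing $R$, with unit group $(\mathbb QR)^*$. $R^\times$ is the monoid of non-zerodivisors of $R$, acting on the additive group of $R$ by multiplication. The constructible subgroups of this action form the smallest family of subgroups of $R$ containing $R$ and closed under $C\mapsto aC$ and $C\mapsto\{x\in R: ax\in C\}$ for $a\in R^\times$; they have finite index, and $\overline R=\varprojlim_C R/C$. The group $\mathbb QR\rtimes(\mathbb QR)^*$ acts on $\mathbb QR$ by affine maps $(b,u).x=b+ux$; restricting to $R$ gives a partial action which extends uniquely to a partial action on $\overline R$ by homeomorphisms between open sets; the groupoid in the statement is the associated partial transformation groupoid (group discrete). *)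

(* Defs.v *)
From HB Require Import structures.
From mathcomp Require Import all_boot all_order all_algebra.
From mathcomp Require Import boolp classical_sets.
Set Implicit Arguments. Unset Strict Implicit. Unset Printing Implicit Defensive.
Import Order.TTheory GRing.Theory Num.Theory.
Local Open Scope classical_set_scope.
Local Open Scope ring_scope.

Definition torsion_free (M : zmodType) : Prop :=
  forall (x : M) (n : nat), x *+ n.+1 = 0 -> x = 0.

Definition finitely_generated (M : zmodType) : Prop :=
  exists s : seq M, forall x : M,
    exists c : 'I_(size s) -> int, x = \sum_(i < size s) s`_i *~ c i.

(* ---------- QR = Q (x)_Z R, via its characteristic (localization) property:
   A is a Q-algebra and i : R -> A a ring map such that every element of A
   is i(r)/n (n > 0) and ker i is the Z-torsion of R.  Then A ~= Q (x)_Z R. *)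
Definition is_rationalization (R : comNzRingType) (A : comAlgType rat)
    (i : {rmorphism R -> A}) : Prop :=
  (forall a : A, exists (r : R) (n : nat), a *+ n.+1 = i r) /\
  (forall r : R, i r = 0 -> exists n : nat, r *+ n.+1 = 0).

Definition is_unit (A : comAlgType rat) (u : A) : Prop := exists v, u * v = 1.

Definition nzdiv (R : comNzRingType) (a : R) : Prop :=
  forall x : R, a * x = 0 -> x = 0.

Inductive constructible (R : comNzRingType) : set R -> Prop :=
| constr_top : constructible setT
| constr_mul (a : R) (C : set R) :
    nzdiv a -> constructible C -> constructible [set a * x | x in C]
| constr_div (a : R) (C : set R) :
    nzdiv a -> constructible C -> constructible [set x | C (a * x)].

Definition coset (R : comNzRingType) (C : set R) (r : R) : set R :=
  [set r + c | c in C].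

(* points of Rbar = lim_C R/C : compatible families assigning to each
   constructible C a coset of C (an element of R/C), and set0 elsewhere *)
Definition rbar_point (R : comNzRingType) (x : set R -> set R) : Prop :=
  [/\ (forall C, constructible C -> exists r, x C = coset C r),
      (forall C, ~ constructible C -> x C = set0) &
      (forall C C', constructible C -> constructible C' -> C `<=` C' ->
         x C `<=` x C')].

Definition act_graph (R : comNzRingType) (A : comAlgType rat)
    (i : {rmorphism R -> A}) (b u : A) : set (R * R) :=
  [set p | i p.2 = b + u * i p.1].

(* an arrow ((b,u), x) with range y = (b,u).x *)
Record arrow (R A : Type) := Arrow {
  ar_b : A; ar_u : A; ar_src : set R -> set R; ar_rng : set R -> set R }.

(* arrows: (x,y) lies in the closure, in Rbar x Rbar, of the graph of the
   partial action of (b,u) on R, i.e. in the graph of its unique extension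
   to Rbar (basic open sets of Rbar: {z | z C = K}, C constructible). *)
Definition pt_groupoid (R : comNzRingType) (A : comAlgType rat)
    (i : {rmorphism R -> A}) : set (arrow R A) :=
  [set g | [/\ is_unit (ar_u g), rbar_point (ar_src g), rbar_point (ar_rng g) &
     forall C1 C2, constructible C1 -> constructible C2 ->
       exists r s, act_graph i (ar_b g) (ar_u g) (r, s) /\
                   ar_src g C1 r /\ ar_rng g C2 s]].

Definition pt_composable (R A : Type) (g h : arrow R A) : Prop :=
  ar_src g = ar_rng h.

(* ((b,u),(b',u').x) * ((b',u'),x) = ((b,u)(b',u'), x) in QR x| QR^* *)
Definition pt_mul (R : comNzRingType) (A : comAlgType rat) (g h : arrow R A) :=
  Arrow (ar_b g + ar_u g * ar_b h) (ar_u g * ar_u h) (ar_src h) (ar_rng g).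

(* topology: subspace of (discrete group) x Rbar, coordinates ((b,u), x) *)
Definition pt_open (R : comNzRingType) (A : comAlgType rat)
    (i : {rmorphism R -> A}) (O : set (arrow R A)) : Prop :=
  O `<=` pt_groupoid i /\
  forall g, O g -> exists C, constructible C /\
    forall h, pt_groupoid i h -> ar_b h = ar_b g -> ar_u h = ar_u g ->
      ar_src h C = ar_src g C -> O h.

(* isomorphism of topological groupoids (given by arrow sets, composability,
   multiplication and open sets): a homeomorphism of arrow spaces which is a
   bijective functor with functorial inverse. *)
Definition top_groupoid_iso (T1 T2 : Type)
    (G1 : set T1) (c1 : T1 -> T1 -> Prop) (m1 : T1 -> T1 -> T1)
    (o1 : set T1 -> Prop)
    (G2 : set T2) (c2 : T2 -> T2 -> Prop) (m2 : T2 -> T2 -> T2)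
    (o2 : set T2 -> Prop) : Prop :=
  exists (f : T1 -> T2) (f' : T2 -> T1),
    (forall a, G1 a -> G2 (f a)) /\ (forall a, G2 a -> G1 (f' a)) /\
    (forall a, G1 a -> f' (f a) = a) /\ (forall a, G2 a -> f (f' a) = a) /\
    (forall a b, G1 a -> G1 b -> (c1 a b <-> c2 (f a) (f b))) /\
    (forall a b, G1 a -> G1 b -> c1 a b -> f (m1 a b) = m2 (f a) (f b)) /\
    (forall O, o2 O -> o1 (G1 `&` f @^-1` O)) /\
    (forall O, o1 O -> o2 (G2 `&` f' @^-1` O)).

Definition affine_groupoid_iso (R1 R2 : comNzRingType) (A1 A2 : comAlgType rat)
    (i1 : {rmorphism R1 -> A1}) (i2 : {rmorphism R2 -> A2}) : Prop :=
  top_groupoid_iso (pt_groupoid i1) (@pt_composable R1 A1) (@pt_mul R1 A1)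
    (pt_open i1)
    (pt_groupoid i2) (@pt_composable R2 A2) (@pt_mul R2 A2) (pt_open i2).

Definition Qalg_iso (A1 A2 : comAlgType rat) (f : A1 -> A2) : Prop :=
  [/\ bijective f, (forall x y, f (x + y) = f x + f y),
      (forall x y, f (x * y) = f x * f y), f 1 = 1 &
      (forall (q : rat) x, f (q *: x) = q *: f x)].

(* Main.v *)
(** An isomorphism of the groupoids carries the translations of [R1] to a cocycle
with values in the affine group of [A2]. Compactness of Rbar and finite generation of [R1]
make it depend on the base point only modulo some integer, so near the point
[x0] that corresponds to [0] in Rbar2 it is a pair [(b, w)] with [w] a
homomorphism and [b (r + s) = b r + w r * b s]. Every unit [v] of [A2] fixes [0],
and the matching isotropy element at [x0] has a linear part [u_v] satisfying
[b (u_v z) = v b z] and [w (u_v z) = w z] for small [z]. For [v = 2] this and the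
injectivity of [b] give [w = 1] on some [M R1], so [b] is additive there and
extends to an injective Q-linear map [B : A1 -> A2] with [B (u_v x) = v B x].
By symmetry the dimensions agree, so [B] is bijective; since units span [A2], [B]
identifies the multiplications of [A2] with multiplications of [A1]. *)

Require Import Defs.
From HB Require Import structures.
From mathcomp Require Import all_boot all_order all_algebra.
From mathcomp Require Import boolp classical_sets.
From mathcomp Require Import ring.
Set Implicit Arguments. Unset Strict Implicit. Unset Printing Implicit Defensive.
Import Order.TTheory GRing.Theory Num.Theory.
Local Open Scope classical_set_scope.
Local Open Scope ring_scope.

(** * Finite-dimensional rational algebras *)

Definition spans (V : lmodType rat) (n : nat) (e : 'I_n -> V) : Prop :=
  forall a : V, exists c : 'I_n -> rat, a = \sum_(j < n) c j *: e j.

Lemma rat_mulrnI (V : lmodType rat) (n : nat) (x y : V) :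
  x *+ n.+1 = y *+ n.+1 -> x = y.
Proof.
rewrite -!scaler_nat => /(congr1 (fun z => n.+1%:R^-1 *: z)).
by rewrite !scalerA mulVf ?pnatr_eq0 // !scale1r.
Qed.

Lemma spans_dependent (V : lmodType rat) (n : nat) (e : 'I_n -> V)
    (x : 'I_n.+1 -> V) :
  spans e ->
  exists c : 'I_n.+1 -> rat,
    (exists j, c j != 0) /\ \sum_(j < n.+1) c j *: x j = 0.
Proof.
move=> he; have [M hM] := choice (fun j => he (x j)).
pose A := \matrix_(j < n.+1, k < n) M j k.
have : kermx A != 0.
  rewrite -mxrank_eq0 mxrank_ker subn_eq0 -ltnNge ltnS.
  exact: rank_leq_col.
case/rowV0Pn=> v /sub_kermxP hv v0.
exists (fun j => v 0 j); split.
  by case/rV0Pn: v0 => j hj; exists j.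
under eq_bigr do rewrite hM scaler_sumr.
rewrite exchange_big big1 //= => k _.
under eq_bigr do rewrite scalerA.
rewrite -scaler_suml; move/matrixP/(_ 0 k): hv; rewrite !mxE => hv.
suff -> : \sum_i v 0 i * M i k = 0 by rewrite scale0r.
by rewrite -[RHS]hv; apply: eq_bigr => j _; rewrite mxE.
Qed.

Lemma additive_ratZ (V W : lmodType rat) (L : V -> W) :
  {morph L : x y / x + y} -> forall (q : rat) x, L (q *: x) = q *: L x.
Proof.
move=> LD.
have L0 : L 0 = 0 by apply: (addrI (L 0)); rewrite -LD !addr0.
have LN x : L (- x) = - L x by apply: (addrI (L x)); rewrite -LD !subrr.
have LM x n : L (x *+ n) = L x *+ n.
  by elim: n => [|n IH]; rewrite ?mulr0n // !mulrS LD IH.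
have LZ (z : int) x : L (z%:~R *: x) = z%:~R *: L x.
  case: z => n; rewrite ?NegzE ?mulrNz ?scaleNr ?LN -?pmulrn !scaler_nat LM //.
move=> q x; have [d hd] : exists d, denq q = d.+1%:Z.
  by case: (denq q) (denq_gt0 q) => [[|d]|] // _; exists d.
apply: (@rat_mulrnI _ d); rewrite -LM -!scaler_nat !scalerA.
have -> : d.+1%:R * q = (numq q)%:~R.
  by rewrite mulrC numqE hd.
exact: LZ.
Qed.

(* A linear relation among [x, L x, .., L^n x] puts [x] in the image of [L]. *)
Lemma injective_endo_surjective (V : lmodType rat) (n : nat) (e : 'I_n -> V)
    (L : V -> V) :
  spans e -> {morph L : x y / x + y} -> injective L ->
  forall x, exists y, L y = x.
Proof.
move=> he LD Linj x.
have LZ := additive_ratZ LD.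
have L0 : L 0 = 0 by apply: (addrI (L 0)); rewrite -LD !addr0.
have LS m (c : 'I_m -> rat) (z : 'I_m -> V) :
    L (\sum_(j < m) c j *: z j) = \sum_(j < m) c j *: L (z j).
  elim: m c z => [|m IH] c z; first by rewrite !big_ord0.
  by rewrite !big_ord_recl LD LZ IH.
have [c [c0 hc]] := spans_dependent (fun j : 'I_n.+1 => iter j L x) he.
elim: n.+1 c c0 hc => [|m IH] c [j c0]; first by case: j c0.
rewrite big_ord_recl /=.
have -> : \sum_(k < m) c (lift ord0 k) *: iter (bump 0 k) L x =
    L (\sum_(k < m) c (lift ord0 k) *: iter k L x) by rewrite LS.
have [c00|c00] := eqVneq (c ord0) 0.
  rewrite c00 scale0r add0r -[RHS]L0 => /Linj; apply: IH.
  case: (unliftP ord0 j) c0 => [k ->|->]; last by rewrite c00 eqxx.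
  by exists k.
move/eqP; rewrite addr_eq0 => /eqP h.
exists (- (c ord0)^-1 *: (\sum_(k < m) c (lift ord0 k) *: iter k L x)).
by rewrite LZ scaleNr -scalerN -h scalerA mulVf // scale1r.
Qed.

(** A linear relation among the powers of [a] gives a nonzero polynomial [p] killing [a]. Choose [q]
    with [p(-q) <> 0]: since [X + q] divides [p - p(-q)], evaluation at [a] shows that [a + q]
    divides the nonzero scalar [-p(-q)]. *)
Lemma exists_shift_unit (A : comAlgType rat) (n : nat) (e : 'I_n -> A) (a : A) :
  spans e -> exists q : nat, is_unit (a + q%:R).
Proof.
move=> he; have [c [[j c0] hc]] := spans_dependent (fun j : 'I_n.+1 => a ^+ j) he.
pose p : {poly rat} := \poly_(j < n.+1) c (inord j).
have p0 : p != 0.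
  apply/eqP => /polyP /(_ j); rewrite coef_poly coef0 ltn_ord inord_val.
  by move/eqP; rewrite (negPf c0).
have pa : horner_alg a p = 0.
  rewrite /p poly_def linear_sum -[RHS]hc; apply: eq_bigr => k _.
  by rewrite linearZ /= rmorphXn /= horner_algX inord_val mulr_algl.
have [q hq] : exists q : nat, p.[- q%:R] != 0.
  apply: contrapT => h.
  have : (size [seq - (q%:R : rat) | q <- iota 0 (size p)] < size p)%N.
    apply: max_poly_roots => //.
      apply/allP => _ /mapP [q _ ->]; apply/rootP.
      by apply: contrapT => /eqP hq; apply: h; exists q.
    rewrite map_inj_uniq ?iota_uniq // => x y /oppr_inj /eqP.
    by rewrite eqr_nat => /eqP.
  by rewrite size_map size_iota ltnn.
exists q.
have : root (p - p.[- q%:R]%:P) (- q%:R) by rewrite /root !hornerE subrr.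
case/factor_theorem => g /(congr1 (horner_alg a)).
rewrite !(rmorphB, rmorphM) /= pa horner_algX !horner_algC sub0r.
set d := p.[_] in hq *; rewrite scaleNr scaler_nat opprK => h.
exists ((- d^-1) *: horner_alg a g).
rewrite -scalerAr mulrC -h scalerN scaleNr opprK scalerA mulVf //.
by rewrite scale1r.
Qed.

(* The [A2]-module structure that [B] transports to [A1] is by multiplications
   of [A1], at least for the units of [A2]. *)
Definition unit_linear_embedding (A1 A2 : comAlgType rat) (B : A1 -> A2) : Prop :=
  [/\ {morph B : x y / x + y}, injective B &
      forall v : A2, is_unit v ->
        exists c : A1, forall x, B (c * x) = v * B x].

(** Write [a = (a + q) - q] with [a + q] a unit; the integer [q] corresponds to itself because [B]
    is additive. *)
Lemma unit_linear_embedding_scalars (A1 A2 : comAlgType rat) n (e : 'I_n -> A2)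
    (B : A1 -> A2) (a : A2) :
  spans e -> unit_linear_embedding B ->
  exists c : A1, forall x, B (c * x) = a * B x.
Proof.
move=> he [BD Binj BU]; have [q hq] := exists_shift_unit a he.
have [c hc] := BU _ hq.
exists (c - q%:R) => x.
apply: (addIr (B (q%:R * x))); rewrite -BD mulrBl subrK hc.
have -> : B (q%:R * x) = q%:R * B x.
  by rewrite -!scaler_nat -!scalerAl !mul1r (additive_ratZ BD).
by rewrite mulrDl.
Qed.
(** Send [a] to the [c] with [B (c * x) = a * B x] for all [x]. Injectivity of [B] makes [c] unique,
    which yields the algebraic identities; an [x] with [B x = 1] recovers [a] from [c]. *)
Lemma unit_linear_embedding_morph (A1 A2 : comAlgType rat) n (e : 'I_n -> A2)
    (B : A1 -> A2) :
  spans e -> unit_linear_embedding B -> (forall y, exists x, B x = y) ->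
  exists f : A2 -> A1,
    [/\ injective f, {morph f : x y / x + y}, {morph f : x y / x * y} & f 1 = 1].
Proof.
move=> he hB Bsurj; have [BD Binj _] := hB.
have [f hf] := choice (fun a => unit_linear_embedding_scalars a he hB).
have eqf c d : (forall x, B (c * x) = B (d * x)) -> c = d.
  by move=> /(_ 1); rewrite !mulr1 => /Binj.
exists f; split.
- move=> a b hab; have [x hx] := Bsurj 1.
  by move: (hf a x); rewrite hab hf hx !mulr1.
- by move=> a b; apply: eqf => x; rewrite mulrDl BD !hf mulrDl.
- by move=> a b; apply: eqf => x; rewrite -mulrA !hf mulrA.
- by apply: eqf => x; rewrite hf !mul1r.
Qed.

(** Injective linear maps in opposite directions compose to an injective endomorphism of a
    finite-dimensional space, which is onto. This applies first to [B] and [B'], then to the algebra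
    maps [f] and [g] they induce. *)
Lemma Qalg_iso_of_embeddings (A1 A2 : comAlgType rat) n1 (e1 : 'I_n1 -> A1)
    n2 (e2 : 'I_n2 -> A2) (B : A1 -> A2) (B' : A2 -> A1) :
  spans e1 -> spans e2 ->
  unit_linear_embedding B -> unit_linear_embedding B' ->
  exists f : A1 -> A2, Qalg_iso f.
Proof.
move=> h1 h2 hB hB'; have [BD Bi _] := hB; have [BD' Bi' _] := hB'.
have Bs y : exists x, B x = y.
  have [z hz] := @injective_endo_surjective _ _ _ (B \o B') h2
    ltac:(by move=> a b /=; rewrite BD' BD) (inj_comp Bi Bi') y.
  by exists (B' z).
have Bs' y : exists x, B' x = y.
  have [z hz] := @injective_endo_surjective _ _ _ (B' \o B) h1
    ltac:(by move=> a b /=; rewrite BD BD') (inj_comp Bi' Bi) y.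
  by exists (B z).
have [f [fi fD fM f1]] := unit_linear_embedding_morph h1 hB' Bs'.
have [g [gi gD _ _]] := unit_linear_embedding_morph h2 hB Bs.
have fs y : exists x, f x = y.
  have [z hz] := @injective_endo_surjective _ _ _ (f \o g) h2
    ltac:(by move=> a b /=; rewrite gD fD) (inj_comp fi gi) y.
  by exists (g z).
have [f' hf'] := choice fs.
exists f; split => //; last exact: additive_ratZ.
by exists f' => // x; apply: fi; rewrite hf'.
Qed.

Lemma spans_basis (V : lmodType rat) (n : nat) (e : 'I_n -> V) :
  spans e ->
  exists m (b : 'I_m -> V), spans b /\
    forall c : 'I_m -> rat, \sum_(j < m) c j *: b j = 0 -> forall j, c j = 0.
Proof.
elim: n e => [|n IH] e he; first by exists 0%N, e; split=> // c _ [].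
have [h|] := pselect (forall c : 'I_n.+1 -> rat,
    \sum_(j < n.+1) c j *: e j = 0 -> forall j, c j = 0).
  by exists n.+1, e.
move/existsNP => [c /not_implyP [hc /existsNP [k /eqP ck]]].
(* The relation [c] with [c k] nonzero eliminates [e k]; the remaining vectors still span. *)
apply: (IH (fun j => e (lift k j))) => a; have [d ->] := he a.
exists (fun j => d (lift k j) - d k / c k * c (lift k j)).
under [RHS]eq_bigr do rewrite scalerBl -scalerA.
rewrite sumrB -scaler_sumr (bigD1_ord k) //=.
move: hc; rewrite (bigD1_ord k) //= => /eqP; rewrite addrC addr_eq0.
move=> /eqP ->; rewrite scalerN opprK scalerA divfK //.
by rewrite addrC.
Qed.

(** Coordinates in a basis are additive because they are unique, and some coordinate of [z] is
    nonzero. *)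
Lemma exists_coordinate (V : lmodType rat) (n : nat) (e : 'I_n -> V) (z : V) :
  spans e -> z != 0 ->
  exists l : V -> rat^o, {morph l : x y / x + y} /\ l z != 0.
Proof.
move=> /spans_basis [m [b [hb hfree]]] z0.
have [c hc] := choice hb.
have [j hj] : exists j, c z j != 0.
  apply: contrapT => h; move/eqP: z0; apply; rewrite (hc z) big1 // => j _.
  have -> : c z j = 0 by apply: contrapT => /eqP hj; apply: h; exists j.
  by rewrite scale0r.
exists (fun a => c a j); split=> // x y.
apply/eqP; rewrite -subr_eq0; apply/eqP.
apply: (hfree (fun j => c (x + y) j - (c x j + c y j))).
under eq_bigr do rewrite scalerBl scalerDl.
by rewrite sumrB big_split /= -!hc subrr.
Qed.

(** * The completion of [R] *)

Section Rationalization.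
Variables (R : comNzRingType) (A : comAlgType rat) (i : {rmorphism R -> A}).
Hypotheses (tf : torsion_free R) (hA : is_rationalization i).

Lemma rationalization_inj : injective i.
Proof.
move=> x y hxy; apply/eqP; rewrite -subr_eq0; apply/eqP.
have [n hn] : exists n, (x - y) *+ n.+1 = 0.
  by apply: hA.2; rewrite rmorphB hxy subrr.
exact: tf hn.
Qed.

Hypothesis fg : finitely_generated R.

Lemma rationalization_spans : exists n (e : 'I_n -> A), spans e.
Proof.
have [s hs] := fg; exists (size s), (fun j => i s`_j) => a.
have [r [n hn]] := hA.1 a; have [c hc] := hs r.
exists (fun j => n.+1%:R^-1 * (c j)%:~R).
apply: (@rat_mulrnI _ n); rewrite hn hc rmorph_sum /= -sumrMnl.
apply: eq_bigr => j _; rewrite rmorphMz -scaler_nat scalerA mulrA.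
by rewrite divff ?pnatr_eq0 // mul1r scaler_int.
Qed.

(** Multiplication by [a] is injective on the finite-dimensional [A], hence onto, so [a] has an
    inverse in [A]; a denominator of this inverse is the integer sought. *)
Lemma nzdiv_dvd_nat (a : R) : nzdiv a -> exists b n, a * b = n.+1%:R.
Proof.
move=> ha; have [m [e he]] := rationalization_spans.
have [||y hy] := @injective_endo_surjective _ _ _ (fun x => i a * x) he _ _ 1.
- by move=> x y /=; rewrite mulrDr.
- move=> x y /eqP; rewrite -subr_eq0 -mulrBr => /eqP h.
  apply/eqP; rewrite -subr_eq0; apply/eqP.
  have [r [n hn]] := hA.1 (x - y).
  apply: (@rat_mulrnI _ n); rewrite hn mul0rn.
  rewrite (ha r) ?rmorph0 //; apply: rationalization_inj.
  by rewrite rmorphM rmorph0 -hn mulrnAr h mul0rn.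
have [r [n hn]] := hA.1 y.
exists r, n; apply: rationalization_inj.
by rewrite rmorphM -hn mulrnAr hy rmorph_nat.
Qed.

End Rationalization.

Section Completion.
Variables (R : comNzRingType).
Implicit Types (C : set R) (x : set R -> set R).

(** For [R] torsion-free and finitely generated, the ideals [n R] with [n > 0] are constructible and
    cofinal among the constructible subgroups, so they define the topology of the completion. *)
Definition natideal (n : nat) : set R := [set n%:R * y | y in setT].

Lemma natidealM n y : natideal n (n%:R * y).
Proof. by exists y. Qed.

Lemma natideal_dvd m n : (m %| n)%N -> natideal n `<=` natideal m.
Proof.
case/dvdnP => k -> _ [y _ <-]; exists (k%:R * y) => //.
by rewrite natrM; ring.
Qed.

Lemma natidealB n y z : natideal n y -> natideal n z -> natideal n (y - z).
Proof. by move=> [a _ <-] [b _ <-]; exists (a - b) => //; rewrite mulrBr. Qed.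

Lemma natidealD n y z : natideal n y -> natideal n z -> natideal n (y + z).
Proof. by move=> [a _ <-] [b _ <-]; exists (a + b) => //; rewrite mulrDr. Qed.

Lemma constructible_ideal C : constructible C ->
  [/\ C 0, (forall y z, C y -> C z -> C (y - z)) &
      (forall r y, C y -> C (r * y))].
Proof.
elim=> {C} [|a C _ _ [C0 CB CM]|a C _ _ [C0 CB CM]]; first by [].
- split; first by exists 0; rewrite ?mulr0.
  + move=> _ _ [y hy <-] [z hz <-]; exists (y - z); first exact: CB.
    by rewrite mulrBr.
  + by move=> r _ [y hy <-]; exists (r * y); [exact: CM | ring].
- split=> /=; first by rewrite mulr0.
  + by move=> y z hy hz; rewrite mulrBr; apply: CB.
  + by move=> r y hy; rewrite mulrCA; apply: CM.
Qed.

Lemma constructible_natideal n : torsion_free R -> constructible (natideal n.+1).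
Proof.
move=> tf; apply: constr_mul; last exact: constr_top.
by move=> y; rewrite mulr_natl => /tf.
Qed.

(** If [n R] lies in [C] and [a b = m], then [m n R = a (n b R)] lies in [a C]. Preimages under [a]
    still contain [n R], since it is an ideal. *)
Lemma constructible_sup_natideal C :
  (forall a : R, nzdiv a -> exists b n, a * b = n.+1%:R) ->
  constructible C -> exists n, natideal n.+1 `<=` C.
Proof.
move=> hdvd; elim=> {C} [|a C ha hC [n hn]|a C ha hC [n hn]]; first by exists 0%N.
- have [b [m hm]] := hdvd a ha.
  exists (m.+1 * n.+1).-1; rewrite prednK ?muln_gt0 // => _ [y _ <-].
  exists (n.+1%:R * (b * y)); first by apply: hn; apply: natidealM.
  by rewrite natrM -hm; ring.
- exists n => _ [y _ <-] /=; rewrite mulrCA; apply: hn; exact: natidealM.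
Qed.

Lemma in_coset C r z : coset C r z <-> C (z - r).
Proof.
split; first by move=> [c hc <-]; rewrite addrC addKr.
by move=> h; exists (z - r) => //; rewrite addrC subrK.
Qed.

Lemma eq_coset C r s : constructible C -> C (r - s) -> coset C r = coset C s.
Proof.
move=> /constructible_ideal [C0 CB CM] h.
have hN : C (s - r) by rewrite -opprB -sub0r; apply: CB.
apply/seteqP; split => z /in_coset hz; apply/in_coset.
  by rewrite (_ : z - s = (z - r) - (s - r)); [apply: CB | ring].
by rewrite (_ : z - r = (z - s) - (r - s)); [apply: CB | ring].
Qed.

Lemma rbar_coset x C r : rbar_point x -> constructible C -> x C r ->
  x C = coset C r.
Proof.
move=> [h _ _] hC; have [s hs] := h _ hC; rewrite hs => /in_coset hr.
by rewrite (eq_coset hC hr).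
Qed.

Lemma rbar_inhabited x C : rbar_point x -> constructible C -> exists r, x C r.
Proof.
move=> [h _ _] hC; have [s hs] := h _ hC; exists s; rewrite hs.
by apply/in_coset; rewrite subrr; case: (constructible_ideal hC).
Qed.

Lemma rbar_eq_sub x x' C C' : rbar_point x -> rbar_point x' ->
  constructible C -> constructible C' -> C `<=` C' -> x C = x' C -> x C' = x' C'.
Proof.
move=> hx hx' hC hC' sCC' e; have [r hr] := rbar_inhabited hx hC.
have [_ _ mx] := hx; have [_ _ mx'] := hx'.
rewrite (rbar_coset hx hC' (mx _ _ hC hC' sCC' _ hr)).
by rewrite e in hr; rewrite (rbar_coset hx' hC' (mx' _ _ hC hC' sCC' _ hr)).
Qed.

Lemma rbar_ext x x' : rbar_point x -> rbar_point x' ->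
  (forall C, constructible C -> exists r, x C r /\ x' C r) -> x = x'.
Proof.
move=> hx hx' h; apply/funext => C; have [hC|hC] := pselect (constructible C).
  have [r [h1 h2]] := h C hC.
  by rewrite (rbar_coset hx hC h1) (rbar_coset hx' hC h2).
by case: hx => _ -> //; case: hx' => _ ->.
Qed.

(** The image of [0] in the completion; the first conjunct enforces the default value [set0] off the
    constructible sets. *)
Definition rbar_zero : set R -> set R := fun C => [set z | constructible C /\ C z].

Lemma rbar_zeroP : rbar_point rbar_zero.
Proof.
split.
- move=> C hC; exists 0; apply/seteqP; split => z /=; rewrite in_coset subr0 //.
  by case.
- by move=> C hC; apply/seteqP; split => z //= [].
- by move=> C C' hC hC' s z /= [_ /s].
Qed.

Definition rbar_shift (r : R) x : set R -> set R :=
  fun C => [set z | x C (z - r)].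

Lemma rbar_shiftP r x : rbar_point x -> rbar_point (rbar_shift r x).
Proof.
move=> hx; have [h1 h2 h3] := hx; split.
- move=> C hC; have [s hs] := h1 _ hC; exists (r + s).
  apply/seteqP; split => z; rewrite /rbar_shift /= hs !in_coset opprD addrA //.
- by move=> C hC; apply/seteqP; split => z //=; rewrite /rbar_shift /= h2.
- by move=> C C' hC hC' s z; apply: h3.
Qed.

Lemma rbar_shiftD r s x : rbar_shift r (rbar_shift s x) = rbar_shift (r + s) x.
Proof.
by apply/funext => C; apply/seteqP; split => z; rewrite /rbar_shift /= opprD addrA.
Qed.

Lemma rbar_shift0 x : rbar_shift 0 x = x.
Proof.
by apply/funext => C; apply/seteqP; split => z; rewrite /rbar_shift /= subr0.
Qed.

Lemma rbar_shift_mem r x C : rbar_point x -> constructible C -> C r ->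
  rbar_shift r x C = x C.
Proof.
move=> hx hC Cr; have [s hs] := rbar_inhabited hx hC.
have hz := rbar_coset hx hC hs.
have [C0 CB _] := constructible_ideal hC.
apply/seteqP; split => z; rewrite /rbar_shift /= hz !in_coset => h.
  rewrite (_ : z - s = (z - r - s) - (0 - r)); last by ring.
  by apply: (CB) => //; apply: CB.
by rewrite (_ : z - r - s = (z - s) - r); [apply: CB | ring].
Qed.

(** Reading the equality modulo each [n > 0] puts [r - s] in every [n R]: translations act
    freely. *)
Lemma rbar_shift_inj r s x : torsion_free R -> rbar_point x ->
  (forall z : R, (forall n, natideal n.+1 z) -> z = 0) ->
  rbar_shift r x = rbar_shift s x -> r = s.
Proof.
move=> tf hx hres e; apply/eqP; rewrite -subr_eq0; apply/eqP; apply: hres => n.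
have hC := constructible_natideal n tf.
have [t ht] := rbar_inhabited hx hC.
have : rbar_shift r x (natideal n.+1) (r + t) by rewrite /rbar_shift /= addrC addKr.
rewrite e /rbar_shift /= (rbar_coset hx hC ht) in_coset.
by rewrite (_ : r + t - s - t = r - s); last by ring.
Qed.

End Completion.

(* A coordinate functional has bounded denominators on [R], so it cannot be
   nonzero at a divisible element. *)
Lemma natideal_residual (R : comNzRingType) (A : comAlgType rat)
    (i : {rmorphism R -> A}) (z : R) :
  torsion_free R -> is_rationalization i -> finitely_generated R ->
  (forall n, natideal n.+1 z) -> z = 0.
Proof.
move=> tf hA fg hz; have [m [e he]] := rationalization_spans hA fg.
have [s hs] := fg.
have [-> //|z0] := eqVneq z 0.
have iz0 : i z != 0.
  apply: contra z0 => /eqP; rewrite -(rmorph0 i).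
  by move/(rationalization_inj tf hA) ->.
have [l [lD lz]] := exists_coordinate he iz0.
have lZ := additive_ratZ lD.
(* A common denominator of [l] on the generators, so that [D * l] is integral on [R]. *)
pose D : rat := \prod_(k < size s) (denq (l (i s`_k)))%:~R.
have D0 : D != 0.
  by apply/prodf_neq0 => k _; rewrite intr_eq0 denq_neq0.
have lS k (x : 'I_k -> A) : l (\sum_(j < k) x j) = \sum_(j < k) l (x j).
  elim: k x => [|k IH] x; last by rewrite !big_ord_recl lD IH.
  by rewrite !big_ord0 -(scale0r (0 : A)) lZ scale0r.
have lint r : D * l (i r) \is a Num.int.
  have [c ->] := hs r; rewrite rmorph_sum lS mulr_sumr.
  apply: rpred_sum => k _; rewrite rmorphMz -scaler_int lZ mulrCA.
  apply: rpredM; first exact: intr_int.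
  rewrite /D (bigD1 k) //= mulrAC -[_ * l _]mulrC -numqE.
  apply: rpredM; first exact: intr_int.
  by apply: rpred_prod => j _; exact: intr_int.
have /intrP [d hd] := lint z.
have d0 : d != 0 by rewrite -(intr_eq0 rat) -hd mulf_neq0.
(* The modulus [|d| + 1] is too large to divide the nonzero integer [d]. *)
have [y _ hy] := hz `|d|%N.
have /intrP [k hk] := lint y.
have hdk : d = `|d|.+1%:Z * k.
  apply: (intr_inj (R := rat)); rewrite -hd -hy rmorphM rmorph_nat /=.
  by rewrite -scaler_nat -scalerAl mul1r lZ intrM -hk; rewrite mulrCA.
have : (`|d|.+1 %| `|d|)%N by rewrite {2}hdk abszM dvdn_mulr.
by move/dvdn_leq; rewrite absz_gt0 d0 => /(_ isT); rewrite ltnn.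
Qed.

(** Reducing the coefficients on the generators modulo [n + 1] leaves finitely many combinations. *)
Lemma natideal_representatives (R : comNzRingType) (n : nat) :
  finitely_generated R ->
  exists L : seq R, forall r, exists2 a, a \in L & natideal n.+1 (r - a).
Proof.
move=> [s hs].
exists [seq \sum_(k < size s) s`_k *+ g k | g : {ffun 'I_(size s) -> 'I_n.+1}].
move=> r; have [c ->] := hs r.
pose g := [ffun k => inord `|(c k %% n.+1%:Z)%Z|%N : 'I_n.+1].
exists (\sum_(k < size s) s`_k *+ g k).
  by apply/mapP; exists g; rewrite ?mem_enum.
exists (\sum_(k < size s) s`_k *~ (c k %/ n.+1%:Z)%Z) => //.
rewrite -sumrB mulr_sumr; apply: eq_bigr => k _.
have hk : (g k : int) = (c k %% n.+1%:Z)%Z.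
  rewrite /g ffunE inordK; first by rewrite gez0_abs ?modz_ge0.
  by rewrite -ltz_nat gez0_abs ?modz_ge0 // ltz_pmod.
rewrite {2}(divz_eq (c k) n.+1%:Z) mulrzDr -hk pmulrn addrK.
by rewrite mulrzA -pmulrn mulr_natl.
Qed.

(** * Compactness of the completion *)

Section Compactness.
Variable R : comNzRingType.
Hypotheses (tf : torsion_free R) (fg : finitely_generated R).
Hypothesis dvd_nat : forall a : R, nzdiv a -> exists b n, a * b = n.+1%:R.

(** Factorials arrange the ideals [n R] into a decreasing cofinal sequence, with [I 0 = R] because
    [0! = 1]. *)
Let I k : set R := @natideal R k`!.

Let I_constructible k : constructible (I k).
Proof. by rewrite /I -(prednK (fact_gt0 k)); apply: constructible_natideal. Qed.

Let I_sub j k : (j <= k)%N -> I k `<=` I j.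
Proof.
move=> h; apply: natideal_dvd; rewrite -(bin_fact h).
by rewrite dvdn_mull // dvdn_mulr.
Qed.

Let I_cofinal C : constructible C -> exists k, I k `<=` C.
Proof.
move=> /(constructible_sup_natideal dvd_nat) [n hn]; exists n.+1.
apply: subset_trans hn; apply: natideal_dvd.
by rewrite dvdn_fact /=.
Qed.

(** The limit of a sequence with [a j.+1 - a j] in [I j]. Any [k] with [I k] inside [C] determines
    the same coset, by [cauchy_pointE]. *)
Definition cauchy_point (a : nat -> R) : set R -> set R :=
  fun C => [set z | constructible C /\ exists k, I k `<=` C /\ C (z - a k)].

Let cauchy_pointE a C k : (forall j, I j (a j.+1 - a j)) -> constructible C ->
  I k `<=` C -> cauchy_point a C = coset C (a k).
Proof.
move=> ha hC hk.
have cau m j : I m (a (m + j)%N - a m).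
  elim: j => [|j IH].
    by rewrite addn0 subrr; exists 0; rewrite ?mulr0.
  rewrite addnS (_ : _ - _ = (a (m + j).+1 - a (m + j)%N) + (a (m + j)%N - a m)).
    by apply: natidealD => //; apply: (I_sub (leq_addr j m)).
  by ring.
have [C0 CB _] := constructible_ideal hC.
apply/seteqP; split => z; rewrite in_coset; last by split=> //; exists k.
move=> [_ [m [hm hz]]].
rewrite (_ : z - a k = (z - a m) - (a k - a m)); last by ring.
apply: (CB) => //; case/orP: (leq_total m k) => /subnKC <-; first exact/hm.
by rewrite -opprB -sub0r; apply: (CB) => //; apply/hk.
Qed.

Let cauchy_pointP a : (forall j, I j (a j.+1 - a j)) -> rbar_point (cauchy_point a).
Proof.
move=> ha; split.
- move=> C hC; have [k hk] := I_cofinal hC; exists (a k).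
  exact: cauchy_pointE.
- by move=> C hC; apply/seteqP; split => z //= [].
- move=> C C' hC hC' s z /= [_ [k [hk hz]]]; split=> //; exists k; split.
    exact: subset_trans s.
  exact: s.
Qed.

(* If no modulus worked, successive refinement modulo [k!] would single out a
   point at which local constancy fails. *)
Lemma rbar_uniformly_constant (T : Type) (F : (set R -> set R) -> T) :
  (forall x, rbar_point x -> exists C, constructible C /\
     forall x', rbar_point x' -> x' C = x C -> F x' = F x) ->
  exists n, forall x x', rbar_point x -> rbar_point x' ->
    x (@natideal R n.+1) = x' (@natideal R n.+1) -> F x = F x'.
Proof.
move=> hF; apply: contrapT => hbad.
pose good k a n := forall x x', rbar_point x -> rbar_point x' ->
    x (I k) a -> x' (I k) a ->
    x (@natideal R n.+1) = x' (@natideal R n.+1) -> F x = F x'.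
have bad0 : ~ exists n, good 0%N 0 n.
  move=> [n hn]; apply: hbad; exists n => x x' hx hx'.
  have all0 y : rbar_point y -> y (I 0%N) 0.
    move=> hy; have [r hr] := rbar_inhabited hy (I_constructible 0).
    rewrite (rbar_coset hy (I_constructible 0) hr) in_coset.
    by exists (0 - r); rewrite // mul1r.
  by apply: hn => //; apply: all0.
(* If all residues modulo [(k + 1)!] above [a] were good, [a] would be good. The implication stands
   under the existential so that [choice] gives a total refinement function. *)
have step (ka : nat * R) : exists a', ~ (exists n, good ka.1 ka.2 n) ->
    I ka.1 (a' - ka.2) /\ ~ exists n, good ka.1.+1 a' n.
  case: ka => k a /=; apply: contrapT => /forallNP h.
  have /not_implyP [hb _] := h 0; apply: hb.
  have {}h a' : exists n, I k (a' - a) -> good k.+1 a' n.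
    have /not_implyP [_ ha'] := h a'.
    apply: contrapT => /forallNP hn; apply: ha'; split.
      by apply: contrapT => h'; apply: (hn 0%N).
    by move=> [n hg]; apply: (hn n).
  have [N hN] := choice h.
  have [L hL] := natideal_representatives (k.+1`!).-1 fg.
  rewrite prednK ?fact_gt0 // in hL.
  (* Divisible by [(k + 1)!], so that congruent points share a representative [b], and by the
     modulus [N b + 1] that works for each [b] in [L]. *)
  pose P := (k.+1`! * \prod_(b <- L) (N b).+1)%N.
  have P0 : (0 < P)%N.
    by rewrite muln_gt0 fact_gt0 prodn_gt0.
  exists P.-1 => x x' hx hx'; rewrite prednK // => xa xa' e.
  have hP : constructible (@natideal R P).
    by rewrite -(prednK P0); apply: constructible_natideal.
  have [t ht] := rbar_inhabited hx (I_constructible k.+1).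
  have [b bL tb] := hL t.
  have xb : x (I k.+1) b.
    rewrite (rbar_coset hx (I_constructible _) ht) in_coset.
    rewrite (_ : b - t = 0 - (t - b)); last by ring.
    by apply: natidealB => //; exists 0; rewrite ?mulr0.
  have xkb : x (I k) b.
    by case: hx => _ _ mx; apply: mx xb => //; apply: I_sub.
  apply: (hN b _ x x') => //.
  - by rewrite (rbar_coset hx (I_constructible _) xa) in_coset in xkb.
  - rewrite -(rbar_eq_sub hx hx' hP (I_constructible _) _ e) //.
    by apply: natideal_dvd; apply: dvdn_mulr.
  - apply: (rbar_eq_sub hx hx' hP _ _ e); first exact: constructible_natideal.
    apply: natideal_dvd; apply: dvdn_mull.
    by rewrite (big_rem b) //= dvdn_mulr.
have [g hg] := choice step.
pose a := fix a k := if k is k'.+1 then g (k', a k') else 0.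
have abad k : ~ exists n, good k (a k) n.
  by elim: k => //= k IH; have [] := hg (k, a k) IH.
have ha j : I j (a j.+1 - a j) by have [] := hg (j, a j) (abad j).
have hx := cauchy_pointP ha.
have [C [hC hloc]] := hF _ hx; have [k hk] := I_cofinal hC.
(* The whole coset of [a k] modulo [I k] lies where [F] is constant, so even the trivial modulus [1]
   is good. *)
apply: (abad k); exists 0%N => y y' hy hy' yk yk' _.
have toF z : rbar_point z -> z (I k) (a k) -> F z = F (cauchy_point a).
  move=> hz zk; apply: hloc => //.
  apply: (rbar_eq_sub hz hx (I_constructible k) hC hk).
  by rewrite (rbar_coset hz (I_constructible k) zk) (@cauchy_pointE a (I k) k).
by rewrite (toF y) // (toF y').
Qed.
End Compactness.

(** * The groupoid and its translations *)

Lemma is_unit_mulI (A : comAlgType rat) (u a b : A) :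
  is_unit u -> u * a = u * b -> a = b.
Proof.
move=> [v uv] /(congr1 (fun z => v * z)).
by rewrite !mulrA [v * u]mulrC uv !mul1r.
Qed.

Lemma is_unit1 (A : comAlgType rat) : is_unit (1 : A).
Proof. by exists 1; rewrite mulr1. Qed.

Definition unit_arrow (R : comNzRingType) (A : comAlgType rat)
  (x : set R -> set R) : arrow R A := Arrow 0 1 x x.

Definition translation (R : comNzRingType) (A : comAlgType rat)
    (i : {rmorphism R -> A}) (r : R) (x : set R -> set R) : arrow R A :=
  Arrow (i r) 1 x (rbar_shift r x).

Section PartialTransformationGroupoid.
Variables (R : comNzRingType) (A : comAlgType rat) (i : {rmorphism R -> A}).
Hypotheses (tf : torsion_free R) (fg : finitely_generated R).
Hypothesis (hA : is_rationalization i).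

Let dvd_nat : forall a : R, nzdiv a -> exists b n, a * b = n.+1%:R :=
  nzdiv_dvd_nat tf hA fg.

Lemma rbar_common x C1 C2 : rbar_point x -> constructible C1 ->
  constructible C2 -> exists r : R, x C1 r /\ x C2 r.
Proof.
move=> hx h1 h2.
have [n1 s1] := constructible_sup_natideal dvd_nat h1.
have [n2 s2] := constructible_sup_natideal dvd_nat h2.
have hP : constructible (@natideal R (n1.+1 * n2.+1).-1.+1).
  exact: constructible_natideal.
have [r hr] := rbar_inhabited hx hP.
rewrite prednK ?muln_gt0 // in hP hr.
case: hx => _ _ mx; exists r; split; apply: (mx _ _ hP) hr => //.
  by apply: subset_trans s1; apply: natideal_dvd; apply: dvdn_mulr.
by apply: subset_trans s2; apply: natideal_dvd; apply: dvdn_mull.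
Qed.

Lemma translation_in r x : rbar_point x -> pt_groupoid i (translation i r x).
Proof.
move=> hx; split => //=; [exact: is_unit1 | exact: rbar_shiftP |].
move=> C1 C2 h1 h2; have [p [p1 p2]] := rbar_common hx h1 h2.
exists p, (r + p); split; first by rewrite /act_graph /= rmorphD mul1r.
by rewrite /rbar_shift /= [r + p]addrC addrK.
Qed.

Lemma translation0 x : translation i 0 x = unit_arrow A x.
Proof. by rewrite /translation rmorph0 rbar_shift0. Qed.

Lemma unit_arrow_in x : rbar_point x -> pt_groupoid i (unit_arrow A x).
Proof. by rewrite -translation0; apply: translation_in. Qed.

Lemma translationD r s x : translation i (r + s) x =
  pt_mul (translation i r (rbar_shift s x)) (translation i s x).
Proof. by rewrite /pt_mul /translation /= mul1r mulr1 rbar_shiftD rmorphD. Qed.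

(* Continuity at [0] of multiplication by [u]. *)
Lemma scale_into_constructible (u : A) C : constructible C ->
  exists C', constructible C' /\
    forall d, C' d -> exists d', C d' /\ i d' = u * i d.
Proof.
move=> hC; have [n hn] := constructible_sup_natideal dvd_nat hC.
have [k [N hN]] := hA.1 u.
exists (@natideal R (N.+1 * n.+1).-1.+1); split.
  exact: constructible_natideal.
rewrite prednK ?muln_gt0 // => _ [y _ <-].
exists (n.+1%:R * (k * y)); split; first by apply: hn; apply: natidealM.
rewrite natrM !rmorphM -hN !rmorph_nat -[u *+ _]mulr_natr; ring.
Qed.

Lemma pt_groupoid_mul g h : pt_groupoid i g -> pt_groupoid i h ->
  pt_composable g h -> pt_groupoid i (pt_mul g h).
Proof.
case: g h => [b u y z] [b' u' x y'] [/= [v uv] hy hz Gg] [/= [v' uv'] hx _ Gh].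
rewrite /pt_composable /= => e; rewrite -{}e in Gh; split => //=.
  by exists (v * v'); rewrite mulrACA uv uv' mulr1.
move=> C1 C3 h1 h3.
(* The approximations of the two arrows meet only modulo [C2]; with [u C2] inside [C3], the mismatch
   [s - s'] moves the endpoint by some [d'] in [C3]. *)
have [C2 [h2 hd]] := scale_into_constructible u h3.
have [r [s [/= ers [xr ys]]]] := Gh _ _ h1 h2.
have [s' [t [/= est [ys' zt]]]] := Gg _ _ h2 h3.
have [d' [Cd' ed']] : exists d', C3 d' /\ i d' = u * i (s - s').
  by apply: hd; apply/in_coset; rewrite -(rbar_coset hy h2 ys').
exists r, (t + d'); split; last split => //.
  move: ers est; rewrite /act_graph /= rmorphD ed' rmorphB => -> ->; ring.
rewrite (rbar_coset hz h3 zt) in_coset.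
by rewrite addrC addKr.
Qed.

(** By continuity, [(b, u)] sends [0] to [b] whatever [u] is. Hence the first component of a cocycle
    value suffices to detect a range. *)
Lemma range_at_zero b u u' y y' :
  pt_groupoid i (Arrow b u (@rbar_zero R) y) ->
  pt_groupoid i (Arrow b u' (@rbar_zero R) y') -> y = y'.
Proof.
move=> [/= _ _ hy G] [/= _ _ hy' G']; apply: rbar_ext => // C hC.
have [D [hD hd]] := scale_into_constructible u hC.
have [D' [hD' hd']] := scale_into_constructible u' hC.
have [r [s [/= ers [[_ Dr] ys]]]] := G _ _ hD hC.
have [r' [s' [/= ers' [[_ Dr'] ys']]]] := G' _ _ hD' hC.
have [d [Cd ed]] := hd _ Dr; have [d' [Cd' ed']] := hd' _ Dr'.
exists s; split=> //; rewrite (rbar_coset hy' hC ys') in_coset.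
have -> : s - s' = d - d'.
  apply: (rationalization_inj tf hA); rewrite !rmorphB ed ed'.
  move: ers ers'; rewrite /act_graph /= => -> ->; ring.
by case: (constructible_ideal hC) => _ CB _; apply: CB.
Qed.

Lemma isotropy_at_zero v : is_unit v ->
  pt_groupoid i (Arrow 0 v (@rbar_zero R) (@rbar_zero R)).
Proof.
move=> hv; split => //=; [exact: rbar_zeroP | exact: rbar_zeroP |].
move=> C1 C2 h1 h2; exists 0, 0; split.
  by rewrite /act_graph /= rmorph0 mulr0 addr0.
by case: (constructible_ideal h1); case: (constructible_ideal h2).
Qed.

(** The affine map [(b, u)] intertwines translation by [z] with translation by [u z], so an arrow
    can be slid along its source with its group component unchanged. *)
Lemma arrow_shift g z z' : pt_groupoid i g -> i z' = ar_u g * i z ->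
  pt_groupoid i (Arrow (ar_b g) (ar_u g) (rbar_shift z (ar_src g))
                       (rbar_shift z' (ar_rng g))).
Proof.
move=> [hu hx hy G] e; split => //=; try exact: rbar_shiftP.
move=> C1 C2 h1 h2; have [r [s [/= ers [xr ys]]]] := G _ _ h1 h2.
exists (r + z), (s + z'); rewrite /rbar_shift /= !addrK; split=> //.
by move: ers; rewrite /act_graph /= !rmorphD e => ->; ring.
Qed.

End PartialTransformationGroupoid.

(** The inverse respects products because the product of [f' a] and [f' b] is again an arrow, on
    which [f'] undoes [f]. *)
Lemma affine_groupoid_iso_sym (R1 R2 : comNzRingType) (A1 A2 : comAlgType rat)
    (i1 : {rmorphism R1 -> A1}) (i2 : {rmorphism R2 -> A2}) :
  torsion_free R1 -> finitely_generated R1 -> is_rationalization i1 ->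
  affine_groupoid_iso i1 i2 -> affine_groupoid_iso i2 i1.
Proof.
move=> tf fg hA [f [f' [fG [fG' [fK [fK' [fc [fm [fo fo']]]]]]]]].
exists f', f; do 4!split=> //; split.
  by move=> a b ha hb; rewrite fc ?fK' //; exact: fG'.
split=> [a b ha hb|]; last by split.
move=> hc; have ha' := fG' _ ha; have hb' := fG' _ hb.
have hc' : pt_composable (f' a) (f' b) by apply/fc => //; rewrite !fK'.
have hab := pt_groupoid_mul tf fg hA ha' hb' hc'.
by rewrite -[RHS](fK _ hab) (fm _ _ ha' hb' hc') !fK'.
Qed.

(** * The translation cocycle of a groupoid isomorphism *)

Section Rigidity.
Variables (R1 R2 : comNzRingType) (A1 A2 : comAlgType rat).
Variables (i1 : {rmorphism R1 -> A1}) (i2 : {rmorphism R2 -> A2}).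
Hypotheses (tf1 : torsion_free R1) (fg1 : finitely_generated R1).
Hypotheses (tf2 : torsion_free R2) (fg2 : finitely_generated R2).
Hypotheses (hA1 : is_rationalization i1) (hA2 : is_rationalization i2).
Variables (f : arrow R1 A1 -> arrow R2 A2) (f' : arrow R2 A2 -> arrow R1 A1).
Hypothesis fG : forall a, pt_groupoid i1 a -> pt_groupoid i2 (f a).
Hypothesis fG' : forall a, pt_groupoid i2 a -> pt_groupoid i1 (f' a).
Hypothesis fK : forall a, pt_groupoid i1 a -> f' (f a) = a.
Hypothesis fK' : forall a, pt_groupoid i2 a -> f (f' a) = a.
Hypothesis fc : forall a b, pt_groupoid i1 a -> pt_groupoid i1 b ->
  (pt_composable a b <-> pt_composable (f a) (f b)).
Hypothesis fm : forall a b, pt_groupoid i1 a -> pt_groupoid i1 b ->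
  pt_composable a b -> f (pt_mul a b) = pt_mul (f a) (f b).
Hypothesis fo : forall O, pt_open i2 O ->
  pt_open i1 (pt_groupoid i1 `&` f @^-1` O).

Definition cocycle (g : arrow R1 A1) : A2 * A2 := (ar_b (f g), ar_u (f g)).

(** The affine group is discrete, so the arrows with a prescribed group component form an open set,
    whose preimage under [f] is open. *)
Lemma cocycle_locally_constant g : pt_groupoid i1 g ->
  exists C, constructible C /\
    forall h, pt_groupoid i1 h -> ar_b h = ar_b g -> ar_u h = ar_u g ->
      ar_src h C = ar_src g C -> cocycle h = cocycle g.
Proof.
move=> hg.
pose O := [set h | pt_groupoid i2 h /\ (ar_b h, ar_u h) = cocycle g].
have /fo [_ /(_ g) []] : pt_open i2 O.
  split=> [h []//|h [hh eh]]; exists setT; split; first exact: constr_top.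
  by move=> k hk eb eu _; split=> //; rewrite eb eu.
  by split=> //; split=> //; apply: fG.
move=> C [hC H]; exists C; split=> // h hh eb eu es.
by have [_ [_]] := H h hh eb eu es.
Qed.

(** The image of a unit is composable with itself and idempotent, which forces its group component
    to be [(0, 1)]. *)
Lemma iso_unit_arrow x : rbar_point x ->
  f (unit_arrow A1 x) = unit_arrow A2 (ar_src (f (unit_arrow A1 x))).
Proof.
move=> hx; have ux := unit_arrow_in tf1 fg1 hA1 hx.
have cx : pt_composable (unit_arrow A1 x) (unit_arrow A1 x) by [].
have := fm ux ux cx; have := (fc ux ux).1 cx; have [hu _ _ _] := fG ux.
have -> : pt_mul (unit_arrow A1 x) (unit_arrow A1 x) = unit_arrow A1 x.
  by rewrite /pt_mul /unit_arrow /= mulr0 mulr1 addr0.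
case: (f _) hu => b u y z /= hu; rewrite /pt_composable /= => <- [eb eu].
have u1 : u = 1 by apply: (is_unit_mulI hu); rewrite -eu mulr1.
rewrite u1 mul1r in eb; rewrite u1 /unit_arrow; congr Arrow.
by apply: (addrI b); rewrite -eb addr0.
Qed.

Lemma src_iso g : pt_groupoid i1 g ->
  ar_src (f g) = ar_src (f (unit_arrow A1 (ar_src g))).
Proof.
move=> hg; have [_ hx _ _] := hg; have ux := unit_arrow_in tf1 fg1 hA1 hx.
have : pt_composable g (unit_arrow A1 (ar_src g)) by [].
by move/(fc hg ux); rewrite /pt_composable (iso_unit_arrow hx).
Qed.

Lemma rng_iso g : pt_groupoid i1 g ->
  ar_rng (f g) = ar_src (f (unit_arrow A1 (ar_rng g))).
Proof.
move=> hg; have [_ _ hx _] := hg; have ux := unit_arrow_in tf1 fg1 hA1 hx.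
have : pt_composable (unit_arrow A1 (ar_rng g)) g by [].
by move/(fc ux hg); rewrite /pt_composable => ->.
Qed.

Lemma src_iso_unit_inj x y : rbar_point x -> rbar_point y ->
  ar_src (f (unit_arrow A1 x)) = ar_src (f (unit_arrow A1 y)) -> x = y.
Proof.
move=> hx hy e; have := iso_unit_arrow hx; rewrite e -(iso_unit_arrow hy).
move/(congr1 f'); rewrite !fK; try exact: (unit_arrow_in tf1 fg1 hA1).
by case.
Qed.

Let c r x := cocycle (translation i1 r x).

Let c_unit r x : rbar_point x -> is_unit (c r x).2.
Proof. by move=> /(translation_in tf1 fg1 hA1 r) /fG []. Qed.

Let c0 x : rbar_point x -> c 0 x = (0, 1).
Proof.
by move=> hx; rewrite /c translation0 /cocycle iso_unit_arrow.
Qed.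

Let cD r s x : rbar_point x -> c (r + s) x =
  ((c r (rbar_shift s x)).1 + (c r (rbar_shift s x)).2 * (c s x).1,
   (c r (rbar_shift s x)).2 * (c s x).2).
Proof.
move=> hx; rewrite /c translationD /cocycle fm //=.
  by apply: translation_in => //; apply: rbar_shiftP.
exact: translation_in.
Qed.

Let periodic n r := forall x x', rbar_point x -> rbar_point x' ->
  x (@natideal R1 n.+1) = x' (@natideal R1 n.+1) -> c r x = c r x'.

Let periodic_dvd m n r : (m.+1 %| n.+1)%N -> periodic m r -> periodic n r.
Proof.
move=> hmn hm x x' hx hx' e; apply: hm => //.
apply: (rbar_eq_sub hx hx' _ _ _ e); try exact: constructible_natideal.
exact: natideal_dvd.
Qed.

Let exists_period1 r : exists n, periodic n r.
Proof.
apply: (rbar_uniformly_constant tf1 fg1 (nzdiv_dvd_nat tf1 hA1 fg1)) => x hx.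
have [C [hC H]] := cocycle_locally_constant (translation_in tf1 fg1 hA1 r hx).
exists C; split=> // x' hx' e; apply: H => //; exact: translation_in.
Qed.

Let periodicD n r s : periodic n r -> periodic n s -> periodic n (r + s).
Proof.
move=> hr hs x x' hx hx' e; rewrite !cD // (hs x x') //.
rewrite (hr (rbar_shift s x) (rbar_shift s x')) //; try exact: rbar_shiftP.
by rewrite /rbar_shift e.
Qed.

(** Solve [c (r - r) x = (0, 1)] for [c (- r) x]; shifting by [- r] preserves congruence, so [c r]
    agrees at the two shifted points. *)
Let periodicN n r : periodic n r -> periodic n (- r).
Proof.
move=> hr x x' hx hx' e.
have h := cD r (- r) hx; have h' := cD r (- r) hx'.
have hu := c_unit r (rbar_shiftP (- r) hx').
have er : c r (rbar_shift (- r) x) = c r (rbar_shift (- r) x').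
  by apply: hr; [exact: rbar_shiftP..|rewrite /rbar_shift e].
move: h h'; rewrite subrr !c0 // er => -> [eb eu].
by rewrite [LHS]surjective_pairing [RHS]surjective_pairing;
   congr pair; apply: (is_unit_mulI hu) => //; apply: addrI eb.
Qed.

(** Compactness gives each generator a period, and the elements having a given period form a
    subgroup; the product of the periods of the generators therefore works throughout. *)
Let exists_period : exists n, forall r, periodic n r.
Proof.
have [s hs] := fg1.
have [n hn] : exists n, forall r, r \in s -> periodic n r.
  elim: s {hs} => [|r s [n IH]]; first by exists 0%N.
  have [m hm] := exists_period1 r; exists (m.+1 * n.+1).-1 => t.
  rewrite in_cons => /orP [/eqP -> | /IH].
    by apply: periodic_dvd hm; rewrite prednK ?muln_gt0 // dvdn_mulr.
  by apply: periodic_dvd; rewrite prednK ?muln_gt0 // dvdn_mull.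
exists n => r; have [z ->] := hs r.
have p0 : periodic n 0 by move=> x x' hx hx' _; rewrite !c0.
have pM t m : periodic n t -> periodic n (t *+ m).
  by move=> ht; elim: m => [|m IH]; rewrite ?mulr0n // mulrS; apply: periodicD.
apply: big_ind => //; first exact: periodicD.
move=> k _; have hk : periodic n s`_k by apply: hn; rewrite mem_nth.
case: (z k) => m; first exact: pM.
by rewrite NegzE mulrNz; apply: periodicN; apply: pM.
Qed.

Let x0 := ar_src (f' (unit_arrow A2 (@rbar_zero R2))).

Let zero_in : pt_groupoid i2 (unit_arrow A2 (@rbar_zero R2)).
Proof. exact: unit_arrow_in (@rbar_zeroP R2). Qed.

Let x0P : rbar_point x0.
Proof. by have [] := fG' zero_in. Qed.

Let f_x0 : f (unit_arrow A1 x0) = unit_arrow A2 (@rbar_zero R2).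
Proof.
by rewrite iso_unit_arrow // -(src_iso (fG' zero_in)) fK'.
Qed.

(** The images of translations at [x0] all start at [0], so by [range_at_zero] the first component
    determines the range, and the range determines the translation by freeness. *)
Lemma cocycle_inj r s :
  (c r x0).1 = (c s x0).1 -> r = s.
Proof.
have tr_in t := translation_in tf1 fg1 hA1 t x0P.
have frE t : f (translation i1 t x0) =
    Arrow (c t x0).1 (c t x0).2 (@rbar_zero R2)
      (ar_src (f (unit_arrow A1 (rbar_shift t x0)))).
  have := src_iso (tr_in t); have := rng_iso (tr_in t).
  rewrite /= f_x0 /c /cocycle /=; case: (f _) => b u y z /= -> ->.
  by [].
have := fG (tr_in r); have := fG (tr_in s); rewrite !frE => + + e.
rewrite e => hs hr; have := range_at_zero tf2 fg2 hA2 hr hs.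
move/(src_iso_unit_inj (rbar_shiftP r x0P) (rbar_shiftP s x0P)).
apply: rbar_shift_inj => // z; exact: (natideal_residual tf1 hA1 fg1).
Qed.

(* The isotropy element [v] at [0] corresponds to an isotropy element at [x0]
   with linear part [u]; conjugating translations by it scales them by [u]. *)
Lemma isotropy_scaling v : is_unit v ->
  exists (u : A1) (m : nat), forall z z',
    natideal m.+1 z -> i1 z' = u * i1 z ->
    (c z' x0).1 = v * (c z x0).1 /\ (c z' x0).2 = (c z x0).2.
Proof.
move=> hv; pose hv0 := Arrow 0 v (@rbar_zero R2) (@rbar_zero R2).
have hv_in : pt_groupoid i2 hv0 by exact: isotropy_at_zero.
pose g := f' hv0; have g_in : pt_groupoid i1 g by exact: fG'.
have fg : f g = hv0 by rewrite /g fK'.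
have u_in := unit_arrow_in tf1 fg1 hA1 x0P.
have gsrc : ar_src g = x0.
  by have /(fc g_in u_in) : pt_composable (f g) (f (unit_arrow A1 x0))
    by rewrite fg f_x0.
have grng : ar_rng g = x0.
  by have /(fc u_in g_in) : pt_composable (f (unit_arrow A1 x0)) (f g)
    by rewrite fg f_x0.
have [C [hC H]] := cocycle_locally_constant g_in.
have [m hm] := constructible_sup_natideal (nzdiv_dvd_nat tf1 hA1 fg1) hC.
exists (ar_u g), m => z z' hz e.
have h_in := arrow_shift g_in e; rewrite gsrc grng in h_in.
set h := Arrow _ _ _ _ in h_in.
(* The source [x0 + z] of [h] is close enough to [x0] for the cocycle to keep its value at [g]. *)
have ch : cocycle h = (0, v).
  have -> : cocycle h = cocycle g; last by rewrite /cocycle fg.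
  by apply: H => //=; rewrite gsrc rbar_shift_mem //; apply: hm.
have tz_in := translation_in tf1 fg1 hA1 z x0P.
have tz'_in := translation_in tf1 fg1 hA1 z' x0P.
(* With [(b, u)] the group component of [g], both products are the arrow from [x0] to [x0 + z'] with
   component [(b + u z, u)]. *)
have : f (pt_mul h (translation i1 z x0)) = f (pt_mul (translation i1 z' x0) g).
  by rewrite /pt_mul /= gsrc e mulr1 !mul1r addrC.
rewrite fm // fm //.
case: ch => hb hu; rewrite /pt_mul fg /= hb hu => -[eb eu _ _].
rewrite /c /cocycle /=; split; first by rewrite add0r mulr0 addr0 in eb.
by apply: (is_unit_mulI hv); rewrite eu mulrC.
Qed.

(* Let [u] be the scaling matched with [v = 2] and write [(b, w)] for the
   cocycle at [x0]. For small [z] and [z' = u z], [w z' = w z] forces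
   [w (z' - z) = 1], hence [b (z' - z) = 2 b z - b z = b z], hence
   [z' - z = z] and [w z = 1]. *)
Lemma cocycle_eventually_additive :
  exists M, forall r s,
    (c (M.+1%:R * (r + s)) x0).1 = (c (M.+1%:R * r) x0).1 + (c (M.+1%:R * s) x0).1.
Proof.
have [n hn] := exists_period.
(* Shifting by [s] does not change [x0] modulo the common period, so the cocycle identity can be
   read at [x0] alone. *)
have cDn r s : natideal n.+1 s -> c (r + s) x0 =
    ((c r x0).1 + (c r x0).2 * (c s x0).1, (c r x0).2 * (c s x0).2).
  move=> hs; rewrite cD // (hn r (rbar_shift s x0) x0) //.
    exact: rbar_shiftP.
  by rewrite rbar_shift_mem //; apply: constructible_natideal.
have two_unit : is_unit (2%:R : A2).
  exists (2%:R^-1 *: 1).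
  by rewrite -scalerAr mulr1 -scaler_nat scalerA mulVf // scale1r.
have [u [m hu]] := isotropy_scaling two_unit.
have [k [N hN]] := hA1.1 u.
(* The factor [n + 1] serves [cDn], [m + 1] serves the scaling relation, and [N + 1] clears the
   denominator of [u]. *)
exists (n.+1 * (m.+1 * N.+1)).-1; rewrite prednK ?muln_gt0 //.
set M := (n.+1 * _)%N.
have w1 y : (c (M%:R * y) x0).2 = 1.
  set z := _ * y; pose z' := (n.+1 * m.+1)%:R * (k * y).
  have ez : i1 z' = u * i1 z.
    rewrite /z' /z /M !rmorphM -hN !rmorph_nat !natrM -[u *+ _]mulr_natr; ring.
  have nz : natideal n.+1 z.
    by apply: natideal_dvd (natidealM _ _); apply: dvdn_mulr.
  have mz : natideal m.+1 z.
    by apply: natideal_dvd (natidealM _ _); rewrite dvdn_mull // dvdn_mulr.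
  have [eb ew] := hu z z' mz ez.
  have cz := cDn (z' - z) z nz; rewrite subrK in cz.
  have eb' := congr1 fst cz; have ew' := congr1 snd cz.
  have w1 : (c (z' - z) x0).2 = 1.
    apply: (is_unit_mulI (c_unit z x0P)).
    by rewrite mulr1 mulrC; exact: etrans (esym ew') ew.
  have {}eb' : (c z' x0).1 = (c (z' - z) x0).1 + (c z x0).1.
    by rewrite -[(c z x0).1]mul1r -w1; exact: eb'.
  rewrite eb in eb'.
  rewrite -[RHS]w1; congr ((c _ x0).2).
  apply: cocycle_inj; apply: (addIr (c z x0).1); rewrite -eb'; ring.
move=> r s; rewrite mulrDr cDn ?w1 ?mul1r //.
by apply: natideal_dvd (natidealM _ _); apply: dvdn_mulr.
Qed.

(** The first cocycle component is additive and injective on a multiple of [R1], hence extends to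
    fractions. Scaling by units is known only for small arguments, but may be checked after
    multiplication by an integer. *)
Lemma exists_unit_linear_embedding : exists B : A1 -> A2, unit_linear_embedding B.
Proof.
have [M hM] := cocycle_eventually_additive.
pose b r := (c (M.+1%:R * r) x0).1.
have bD r s : b (r + s) = b r + b s by exact: hM.
have bM r n : b (r *+ n) = b r *+ n.
  elim: n => [|n IH]; last by rewrite !mulrS bD IH.
  by rewrite !mulr0n; apply: (addrI (b 0)); rewrite -bD !addr0.
have binj r s : b r = b s -> r = s.
  move=> /cocycle_inj /eqP; rewrite -subr_eq0 -mulrBr mulr_natl => /eqP /tf1.
  by move/eqP; rewrite subr_eq0 => /eqP.
have iinj := rationalization_inj tf1 hA1.
have frac a : exists rn : R1 * nat, a *+ rn.2.+1 = i1 rn.1.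
  by have [r [n h]] := hA1.1 a; exists (r, n).
have [q hq] := choice frac.
pose B a := ((q a).2.+1%:R : rat)^-1 *: b (q a).1.
have BE a r n : a *+ n.+1 = i1 r -> B a *+ n.+1 = b r.
  move=> h; apply: (@rat_mulrnI _ (q a).2).
  rewrite mulrnAC -[B a *+ (q a).2.+1]scaler_nat scalerA divff ?pnatr_eq0 //.
  rewrite scale1r -!bM; congr b; apply: iinj.
  by rewrite !rmorphMn /= -hq -h mulrnAC.
have common a a' : exists r r' n, a *+ n.+1 = i1 r /\ a' *+ n.+1 = i1 r'.
  exists ((q a).1 *+ (q a').2.+1), ((q a').1 *+ (q a).2.+1).
  exists ((q a).2.+1 * (q a').2.+1).-1; rewrite prednK ?muln_gt0 //.
  by rewrite !rmorphMn /= -!hq -!mulrnA [((q a').2.+1 * _)%N]mulnC.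
exists B; split.
- move=> a a'; have [r [r' [n [h h']]]] := common a a'.
  apply: (@rat_mulrnI _ n); rewrite mulrnDl (BE _ _ _ h) (BE _ _ _ h') -bD.
  by apply: BE; rewrite mulrnDl h h' rmorphD.
- move=> a a' e; have [r [r' [n [h h']]]] := common a a'.
  apply: (@rat_mulrnI _ n); rewrite h h'; congr (i1 _); apply: binj.
  by rewrite -(BE _ _ _ h) -(BE _ _ _ h') e.
- move=> v hv; have [u [m hu]] := isotropy_scaling hv.
  exists u => a; have [r [n h]] := hA1.1 a; have [k [N hN]] := hA1.1 u.
  have hua : (u * a) *+ (N.+1 * n.+1).-1.+1 = i1 (k * r).
    rewrite prednK ?muln_gt0 // rmorphM -hN -h mulrnAl mulrnAr -mulrnA.
    by rewrite mulnC.
  have := BE _ _ _ hua; rewrite prednK ?muln_gt0 // => hB.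
  (* The factor [m + 1] makes the argument small enough for [hu]; [N + 1] and [n + 1] clear the
     denominators of [u] and [a]. *)
  apply: (@rat_mulrnI _ (m.+1 * (N.+1 * n.+1)).-1); rewrite prednK ?muln_gt0 //.
  rewrite [(m.+1 * _)%N]mulnC mulrnA hB -bM.
  have small : natideal m.+1 (M.+1%:R * (r *+ (m.+1 * N.+1))).
    exists (M.+1%:R * (r *+ N.+1)) => //.
    by rewrite -[r *+ N.+1]mulr_natr -[r *+ _]mulr_natr natrM; ring.
  have scaled : i1 (M.+1%:R * ((k * r) *+ m.+1)) =
      u * i1 (M.+1%:R * (r *+ (m.+1 * N.+1))).
    rewrite -[_ *+ m.+1]mulr_natr -[r *+ _]mulr_natr natrM !rmorphM -hN.
    by rewrite !rmorph_nat -[u *+ _]mulr_natr; ring.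
  rewrite /b; have [-> _] := hu _ _ small scaled.
  rewrite -/(b _) bM -(BE _ _ _ h) -mulrnAr; congr (v * _).
  by rewrite -mulrnA [(N.+1 * _)%N]mulnC -mulnA [(N.+1 * _)%N]mulnC.
Qed.

End Rigidity.

Theorem theorem5p5 (R1 R2 : comNzRingType)
    (fg1 : finitely_generated R1) (tf1 : torsion_free R1)
    (fg2 : finitely_generated R2) (tf2 : torsion_free R2)
    (A1 A2 : comAlgType rat)
    (i1 : {rmorphism R1 -> A1}) (i2 : {rmorphism R2 -> A2})
    (hA1 : is_rationalization i1) (hA2 : is_rationalization i2) :
  affine_groupoid_iso i1 i2 -> exists f : A1 -> A2, Qalg_iso f.
Proof.
move=> hiso.
have hiso' := affine_groupoid_iso_sym tf1 fg1 hA1 hiso.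
have [B hB] : exists B : A1 -> A2, unit_linear_embedding B.
  case: hiso => [f [f' [fG [fG' [fK [fK' [fc [fm [fo fo']]]]]]]]].
  exact: (exists_unit_linear_embedding tf1 fg1 tf2 fg2 hA1 hA2
    fG fG' fK fK' fc fm fo).
have [B' hB'] : exists B : A2 -> A1, unit_linear_embedding B.
  case: hiso' => [f [f' [fG [fG' [fK [fK' [fc [fm [fo fo']]]]]]]]].
  exact: (exists_unit_linear_embedding tf2 fg2 tf1 fg1 hA2 hA1
    fG fG' fK fK' fc fm fo).
have [n1 [e1 h1]] := rationalization_spans hA1 fg1.
have [n2 [e2 h2]] := rationalization_spans hA2 fg2.
exact: Qalg_iso_of_embeddings h1 h2 hB hB'.
Qed.
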